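(* Let $\overline{x},\overline{y},\overline{z}$ be pairwise disjoint sets of variables and let $\Sigma_1(\overline{x},\overline{y})$ and $\Sigma_2(\overline{y},\overline{z})$ be theories in the variables $\overline{x}\cup\overline{y}$ and $\overline{y}\cup\overline{z}$ respectively. Then $\Sigma_1\cup\Sigma_2$ is satisfiable if, and only if, there is no term $s(\overline{y})$ (in the variables $\overline{y}$ only) such that $\Sigma_1\models_\Delta s\approx 0$ and $\Sigma_2\models_\Delta s\approx 1$.
   Context: An MV-algebra is an algebra $(A,\oplus,\neg,0)$ of type $(2,1,0)$ such that $(A,\oplus,0)$ is a commutative monoid, $\neg\neg a=a$, $a\oplus\neg 0=\neg 0$, and $\neg(\neg a\oplus b)\oplus b=\neg(\neg b\oplus a)\oplus a$. Derived operations: $1:=\neg 0$, $a\odot b:=\neg(\neg a\oplus\neg b)$, $a\ominus b:=a\odot\neg b$, $a\vee b:=\neg(\neg a\oplus b)\oplus b$ (join of a lattice order $\le$), $d(a,b):=(a\ominus b)\oplus(b\ominus a)$. Let $\mathcal{L}=\{\delta,\oplus,\neg,0\}$ of type $(\omega,2,1,0)$; $\tfrac12(x):=\delta(x,0,0,\dots)$. A $\delta$-algebra is an $\mathcal{L}$-algebra whose MV-reduct is an MV-algebra and satisfying for all $x,y,\vec x,\vec y$: (i) $d(\delta(\vec x),\delta(x_1,0,0,\dots))=\delta(0,x_2,x_3,\dots)$; (ii) $\tfrac12(\delta(\vec x))=\delta(\tfrac12(x_1),\tfrac12(x_2),\dots)$; (iii) $\delta(x,x,\dots)=x$; (iv)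 $\delta(0,\vec x)=\tfrac12(\delta(\vec x))$; (v) $\delta(\vec x)\le\delta(x_1\oplus y_1,x_2\oplus y_2,\dots)$; (vi) $\tfrac12(x\ominus y)=\tfrac12(x)\ominus\tfrac12(y)$. Terms are elements of the absolutely free $\mathcal{L}$-algebra on a set of variables; equations are pairs $s\approx t$ of terms; a theory is a set of equations. For an assignment $f$ of the variables into an $\mathcal{L}$-algebra $A$, $\bar f$ is its homomorphic extension to terms and $A,f\models\Sigma$ means $\bar f(s)=\bar f(t)$ for all $s\approx t\in\Sigma$. $\Sigma\models_\Delta\sigma$ means: for every $\delta$-algebra $A$ and every assignment $f$ of the variables involved (here all of $\overline{x}\cup\overline{y}\cup\overline{z}$) into $A$, $A,f\models\Sigma$ implies $A,f\models\sigma$. A theory is satisfiable if some $\delta$-algebra with at least two elements and some assignment into it satisfy it. *)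

(* Defs.v *)
Set Implicit Arguments.

Inductive term (V : Type) : Type :=
  | Tvar : V -> term V
  | Tdelta : (nat -> term V) -> term V
  | Toplus : term V -> term V -> term V
  | Tneg : term V -> term V
  | Tzero : term V.
Arguments Tzero {V}.

Definition Tone {V : Type} : term V := Tneg Tzero.

Inductive occurs {V : Type} (v : V) : term V -> Prop :=
  | occ_var : occurs v (Tvar v)
  | occ_delta : forall ts n, occurs v (ts n) -> occurs v (Tdelta ts)
  | occ_oplus_l : forall s t, occurs v s -> occurs v (Toplus s t)
  | occ_oplus_r : forall s t, occurs v t -> occurs v (Toplus s t)
  | occ_neg : forall s, occurs v s -> occurs v (Tneg s).

Definition term_in {V : Type} (P : V -> Prop) (t : term V) : Prop :=
  forall v, occurs v t -> P v.

Definition equation (V : Type) : Type := (term V * term V)%type.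
Definition theory (V : Type) : Type := equation V -> Prop.

Definition theory_in {V : Type} (P : V -> Prop) (S : theory V) : Prop :=
  forall e, S e -> term_in P (fst e) /\ term_in P (snd e).

Definition theory_union {V : Type} (S1 S2 : theory V) : theory V :=
  fun e => S1 e \/ S2 e.

Record deltaAlg : Type := DeltaAlg {
  car :> Type;
  dl : (nat -> car) -> car;
  op : car -> car -> car;
  ng : car -> car;
  zr : car;
  op_assoc : forall a b c, op a (op b c) = op (op a b) c;
  op_comm : forall a b, op a b = op b a;
  op_zero : forall a, op a zr = a;
  ng_ng : forall a, ng (ng a) = a;
  op_one : forall a, op a (ng zr) = ng zr;
  mv_luk : forall a b, op (ng (op (ng a) b)) b = op (ng (op (ng b) a)) a;
  (* delta-algebra axioms (sequences x_1, x_2, ... indexed from 0) *)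
  dl_i : forall xs : nat -> car,
    let d a b := op (ng (op (ng a) (ng (ng b)))) (ng (op (ng b) (ng (ng a)))) in
    d (dl xs) (dl (fun n => match n with 0 => xs 0 | _ => zr end))
    = dl (fun n => match n with 0 => zr | _ => xs n end);
  dl_ii : forall xs : nat -> car,
    let half x := dl (fun n => match n with 0 => x | _ => zr end) in
    half (dl xs) = dl (fun n => half (xs n));
  dl_iii : forall x, dl (fun _ => x) = x;
  dl_iv : forall xs : nat -> car,
    let half x := dl (fun n => match n with 0 => x | _ => zr end) in
    dl (fun n => match n with 0 => zr | S k => xs k end) = half (dl xs);
  dl_v : forall xs ys : nat -> car,
    let join a b := op (ng (op (ng a) b)) b in
    join (dl xs) (dl (fun n => op (xs n) (ys n))) = dl (fun n => op (xs n) (ys n));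
  dl_vi : forall x y,
    let half x := dl (fun n => match n with 0 => x | _ => zr end) in
    let ominus a b := ng (op (ng a) (ng (ng b))) in
    half (ominus x y) = ominus (half x) (half y)
}.

Definition one (A : deltaAlg) : A := ng A (zr A).
Definition odot (A : deltaAlg) (a b : A) : A := ng A (op A (ng A a) (ng A b)).
Definition ominus (A : deltaAlg) (a b : A) : A := odot A a (ng A b).
Definition join (A : deltaAlg) (a b : A) : A := op A (ng A (op A (ng A a) b)) b.
Definition le (A : deltaAlg) (a b : A) : Prop := join A a b = b.

Fixpoint eval (A : deltaAlg) {V : Type} (f : V -> A) (t : term V) : A :=
  match t with
  | Tvar v => f v
  | Tdelta ts => dl A (fun n => eval A f (ts n))
  | Toplus s u => op A (eval A f s) (eval A f u)
  | Tneg s => ng A (eval A f s)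
  | Tzero => zr A
  end.

Definition models (A : deltaAlg) {V : Type} (f : V -> A) (S : theory V) : Prop :=
  forall e, S e -> eval A f (fst e) = eval A f (snd e).

Definition entails {V : Type} (S : theory V) (e : equation V) : Prop :=
  forall (A : deltaAlg) (f : V -> A),
    models A f S -> eval A f (fst e) = eval A f (snd e).

Definition satisfiable {V : Type} (S : theory V) : Prop :=
  exists (A : deltaAlg) (f : V -> A), (exists a b : A, a <> b) /\ models A f S.

(* Main.v *)
(* If no term [s] separates the theories, Zorn's lemma gives a maximal [S1]-ideal [M1]
   of terms containing every [Y]-term that [S2] proves equal to 0, and then a maximal
   [S2]-ideal [M2] containing every [Y]-term of [M1]; by maximality, [M1] and [M2] have
   the same [Y]-terms.  A maximal ideal orders the terms totally, and comparing a term
   with the dyadic constants (iterated halves of 1 and their multiples) determines its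
   value in [0, 1].  This valuation is a homomorphism into the standard algebra on
   [0, 1]: delta is preserved because [δ(x0, x1, ...) = ½x0 ⊕ ½δ(x1, x2, ...)] pins it
   down as the sum of [xn / 2^(n+1)].  The valuations of [M1] and [M2] agree on [Y],
   so together they give one assignment satisfying both theories. *)

From Stdlib Require Import Reals Lra Lia Classical ClassicalEpsilon.
From Stdlib Require Import FunctionalExtensionality ProofIrrelevance.
From Coquelicot Require Import Hierarchy Series.
From mathcomp Require classical_sets.
Require Import Defs.

Set Implicit Arguments.
Local Open Scope nat_scope.

(** * Arithmetic of delta-algebras *)

(** This is [ominus] with its double negation cancelled. *)
Definition sub {A : deltaAlg} (a b : A) : A := ng A (op A (ng A a) b).

Local Notation "a ⊕ b" := (op _ a b) (at level 50, left associativity).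
Local Notation "a ⊖ b" := (sub a b) (at level 50, left associativity).
Local Notation "¬ a" := (ng _ a) (at level 35, right associativity).
Local Notation "0̂" := (zr _).
Local Notation "1̂" := (ng _ (zr _)).

(** The lattice order as a single equation; residuation, [sub_le_iff], then reduces to
    associativity. *)
Definition mv_le {A : deltaAlg} (a b : A) : Prop := ¬ a ⊕ b = 1̂.
Local Notation "a ≼ b" := (mv_le a b) (at level 70).

Lemma zero_op (A : deltaAlg) (a : A) : 0̂ ⊕ a = a.
Proof. now rewrite op_comm, op_zero. Qed.

Lemma one_op (A : deltaAlg) (a : A) : 1̂ ⊕ a = 1̂.
Proof. now rewrite op_comm, op_one. Qed.

Lemma ng_one (A : deltaAlg) : ¬ 1̂ = 0̂ :> A.
Proof. apply ng_ng. Qed.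

Lemma ng_op_self (A : deltaAlg) (a : A) : ¬ a ⊕ a = 1̂.
Proof.
  pose proof (mv_luk A a 1̂) as H.
  now rewrite !op_one, ng_one, zero_op in H.
Qed.

Lemma op_ACA (A : deltaAlg) (a b c d : A) : (a ⊕ b) ⊕ (c ⊕ d) = (a ⊕ c) ⊕ (b ⊕ d).
Proof.
  rewrite <- !op_assoc; f_equal.
  now rewrite !op_assoc, (op_comm A b c).
Qed.

(** The left side is the join of [a] and [b]. Hence [a ≼ b] exactly when [b] is [a ⊕ c] for some
    [c], the form used for transitivity and monotonicity. *)
Lemma op_sub (A : deltaAlg) (a b : A) : a ≼ b -> a ⊕ (b ⊖ a) = b.
Proof.
  intros H. rewrite op_comm. unfold sub.
  rewrite <- mv_luk, H, ng_one. apply zero_op.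
Qed.

Lemma le_op_l (A : deltaAlg) (a b : A) : a ≼ a ⊕ b.
Proof. unfold mv_le. now rewrite op_assoc, ng_op_self, one_op. Qed.

Lemma le_op_r (A : deltaAlg) (a b : A) : b ≼ a ⊕ b.
Proof. rewrite op_comm. apply le_op_l. Qed.

Lemma le_refl (A : deltaAlg) (a : A) : a ≼ a.
Proof. apply ng_op_self. Qed.

Lemma le_eq (A : deltaAlg) (a b : A) : a = b -> a ≼ b.
Proof. intros ->. apply le_refl. Qed.

Lemma le_trans (A : deltaAlg) (a b c : A) : a ≼ b -> b ≼ c -> a ≼ c.
Proof.
  intros H1 H2. rewrite <- (op_sub H2), <- (op_sub H1), <- op_assoc.
  apply le_op_l.
Qed.

Lemma le_antisym (A : deltaAlg) (a b : A) : a ≼ b -> b ≼ a -> a = b.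
Proof.
  intros H1 H2. pose proof (mv_luk A a b) as H.
  now rewrite H1, H2, ng_one, !zero_op in H.
Qed.

Lemma zero_le (A : deltaAlg) (a : A) : 0̂ ≼ a.
Proof. apply one_op. Qed.

Lemma le_one (A : deltaAlg) (a : A) : a ≼ 1̂.
Proof. apply op_one. Qed.

Lemma op_le (A : deltaAlg) (a b c d : A) : a ≼ b -> c ≼ d -> a ⊕ c ≼ b ⊕ d.
Proof.
  intros H1 H2. rewrite <- (op_sub H1), <- (op_sub H2), op_ACA. apply le_op_l.
Qed.

Lemma ng_le (A : deltaAlg) (a b : A) : a ≼ b -> ¬ b ≼ ¬ a.
Proof. unfold mv_le. now rewrite ng_ng, op_comm. Qed.

Lemma sub_le_iff (A : deltaAlg) (a b c : A) : a ⊖ b ≼ c <-> a ≼ b ⊕ c.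
Proof. unfold mv_le, sub. now rewrite ng_ng, op_assoc. Qed.

Lemma sub_le (A : deltaAlg) (a b : A) : a ⊖ b ≼ a.
Proof. apply sub_le_iff, le_op_r. Qed.

Lemma le_op_sub (A : deltaAlg) (a b : A) : a ≼ b ⊕ (a ⊖ b).
Proof. apply sub_le_iff, le_refl. Qed.

Lemma sub_eq0 (A : deltaAlg) (a b : A) : a ⊖ b = 0̂ <-> a ≼ b.
Proof.
  unfold sub, mv_le; split; intros H.
  - now rewrite <- H, ng_ng.
  - now rewrite H, ng_one.
Qed.

Lemma sub_op (A : deltaAlg) (a b c : A) : a ⊖ (b ⊕ c) = a ⊖ b ⊖ c.
Proof. unfold sub. now rewrite ng_ng, op_assoc. Qed.

Lemma sub_mono (A : deltaAlg) (a b c d : A) : a ≼ b -> d ≼ c -> a ⊖ c ≼ b ⊖ d.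
Proof.
  intros H1 H2. apply sub_le_iff. apply le_trans with (1 := H1).
  apply le_trans with (1 := le_op_sub _ b d). apply op_le; [exact H2 | apply le_refl].
Qed.

Lemma sub_triangle (A : deltaAlg) (a b c : A) : a ⊖ c ≼ (a ⊖ b) ⊕ (b ⊖ c).
Proof.
  apply sub_le_iff. rewrite (op_comm A (a ⊖ b)), op_assoc.
  apply le_trans with (1 := le_op_sub _ a b).
  apply op_le; [apply le_op_sub | apply le_refl].
Qed.

Lemma op_sub_op (A : deltaAlg) (a b c d : A) : (a ⊕ c) ⊖ (b ⊕ d) ≼ (a ⊖ b) ⊕ (c ⊖ d).
Proof. apply sub_le_iff. rewrite op_ACA. apply op_le; apply le_op_sub. Qed.

Lemma sub_ng (A : deltaAlg) (a b : A) : ¬ a ⊖ ¬ b = b ⊖ a.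
Proof. unfold sub. now rewrite ng_ng, op_comm. Qed.

(** Both sides are the meet of [a] and [b]: this is the dual of [mv_luk]. *)
Lemma sub_sub_comm (A : deltaAlg) (a b : A) : a ⊖ (a ⊖ b) = b ⊖ (b ⊖ a).
Proof.
  pose proof (mv_luk A (¬ a) (¬ b)) as H. unfold sub.
  rewrite !ng_ng in H. f_equal.
  now rewrite (op_comm A (¬ a) b), (op_comm A (¬ b) a), (op_comm A (¬ a)), (op_comm A (¬ b)).
Qed.

(** The left side is the meet of [¬ b] and [a], so nothing is truncated when [a ≼ ¬ b]. *)
Lemma op_subK (A : deltaAlg) (a b : A) : a ≼ ¬ b -> (a ⊕ b) ⊖ b = a.
Proof.
  intros H. replace ((a ⊕ b) ⊖ b) with (¬ b ⊖ (¬ b ⊖ a)).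
  - rewrite sub_sub_comm. apply sub_eq0 in H. rewrite H. unfold sub.
    now rewrite op_zero, ng_ng.
  - unfold sub. rewrite !ng_ng. f_equal. now rewrite op_comm, (op_comm A b).
Qed.

(** The equation [a ⊖ b = a] expresses that the meet of [a] and [b] is 0, which is symmetric. *)
Lemma sub_id_sym (A : deltaAlg) (a b : A) : a ⊖ b = a -> b ⊖ a = b.
Proof.
  intros H. apply le_antisym; [apply sub_le|].
  apply sub_eq0. rewrite sub_sub_comm, H. apply sub_eq0, le_refl.
Qed.

(* With [m] the meet of [a] and [b], any lower bound [c] of [a ⊖ m] and [b ⊖ m]
   satisfies [c ⊕ m ≼ a, b], hence [c ⊕ m ≼ m] and [c = 0]. *)
Lemma sub_prelinear (A : deltaAlg) (a b : A) : (a ⊖ b) ⊖ (b ⊖ a) = a ⊖ b.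
Proof.
  set (p := a ⊖ b). set (q := b ⊖ a). set (m := a ⊖ p). set (c := p ⊖ (p ⊖ q)).
  assert (Hmq : m = b ⊖ q) by apply sub_sub_comm.
  assert (Hpm : p ⊕ m = a) by apply (op_sub (sub_le _ a b)).
  assert (Hqm : q ⊕ m = b) by (rewrite Hmq; apply (op_sub (sub_le _ b a))).
  assert (Hcp : c ≼ p) by apply sub_le.
  assert (Hcq : c ≼ q) by (unfold c; rewrite sub_sub_comm; apply sub_le).
  assert (Hca : c ⊕ m ≼ a) by (rewrite <- Hpm; apply op_le; [exact Hcp | apply le_refl]).
  assert (Hcb : c ⊕ m ≼ b) by (rewrite <- Hqm; apply op_le; [exact Hcq | apply le_refl]).
  assert (Hm : forall e : A, e ≼ a -> e ≼ b -> e ≼ m).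
  { intros e Ha Hb. apply le_trans with (e ⊖ (e ⊖ b)).
    - apply sub_eq0 in Hb. rewrite Hb. apply le_eq. unfold sub. now rewrite op_zero, ng_ng.
    - rewrite sub_sub_comm, Hmq.
      apply sub_mono; [apply le_refl|]. apply sub_mono; [apply le_refl | exact Ha]. }
  pose proof (Hm _ Hca Hcb) as Hcm.
  assert (Hc : c = 0̂).
  { rewrite <- (@op_subK A c m).
    - now apply sub_eq0.
    - apply le_trans with (1 := Hcp). unfold m, sub at 1. rewrite ng_ng. apply le_op_r. }
  apply le_antisym; [apply sub_le|]. now apply sub_eq0.
Qed.

(** * Multiples of an element *)

Fixpoint nmul {A : deltaAlg} (n : nat) (a : A) : A :=
  match n with 0 => 0̂ | S k => a ⊕ nmul k a end.

Lemma nmul_add (A : deltaAlg) (m n : nat) (a : A) : nmul (m + n) a = nmul m a ⊕ nmul n a.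
Proof.
  induction m as [|m IH]; simpl.
  - now rewrite zero_op.
  - now rewrite IH, op_assoc.
Qed.

Lemma nmul_mul (A : deltaAlg) (m n : nat) (a : A) : nmul (m * n) a = nmul m (nmul n a).
Proof. induction m as [|m IH]; simpl; [easy | now rewrite nmul_add, IH]. Qed.

Lemma nmul_le (A : deltaAlg) (m n : nat) (a : A) : m <= n -> nmul m a ≼ nmul n a.
Proof.
  intros H. replace n with (m + (n - m)) by lia. rewrite nmul_add. apply le_op_l.
Qed.

Lemma sub_id_nmul (A : deltaAlg) (n : nat) (a b : A) : a ⊖ b = a -> a ⊖ nmul n b = a.
Proof.
  intros H. induction n as [|n IH]; simpl.
  - unfold sub. now rewrite op_zero, ng_ng.
  - now rewrite sub_op, H.
Qed.

(** The two opposite differences are disjoint by [sub_prelinear], and disjointness passes to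
    multiples on either side. This is what makes a maximal ideal order the terms totally. *)
Lemma sub_nmul_ng (A : deltaAlg) (n m : nat) (a b : A) :
  ¬ nmul n (a ⊖ b) ⊕ ¬ nmul m (b ⊖ a) = 1̂.
Proof.
  assert (H : nmul n (a ⊖ b) ⊖ nmul m (b ⊖ a) = nmul n (a ⊖ b)).
  { apply sub_id_nmul, sub_id_sym, sub_id_nmul, sub_id_sym, sub_prelinear. }
  change (nmul n (a ⊖ b) ≼ ¬ nmul m (b ⊖ a)). rewrite <- H.
  unfold sub at 1. apply ng_le, le_op_r.
Qed.

(** * Halving and the recursion for delta *)

Definition half {A : deltaAlg} (a : A) : A :=
  dl A (fun n => match n with 0 => a | _ => zr A end).

Lemma dl_le (A : deltaAlg) (xs ys : nat -> A) :
  dl A xs ≼ dl A (fun n => xs n ⊕ ys n).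
Proof. rewrite <- (dl_v A xs ys), mv_luk. apply le_op_r. Qed.

(** Axiom (v), with [xs] split as the sum of its head and its tail padded by zeros. *)
Lemma half_le_dl (A : deltaAlg) (xs : nat -> A) : half (xs 0) ≼ dl A xs.
Proof.
  pose proof (dl_le A (fun n => match n with 0 => xs 0 | _ => 0̂ end)
                      (fun n => match n with 0 => 0̂ | S _ => xs n end)) as H.
  apply le_trans with (1 := H), le_eq. f_equal.
  extensionality n. destruct n; [apply op_zero | apply zero_op].
Qed.

(** By [half_le_dl] one of the two differences in the distance of axiom (i) vanishes; axiom (iv)
    turns the right side of (i) into a half. *)
Lemma dl_sub_half (A : deltaAlg) (xs : nat -> A) :
  dl A xs ⊖ half (xs 0) = half (dl A (fun n => xs (S n))).
Proof.
  pose proof (dl_i A xs) as H. cbv beta zeta in H. rewrite !ng_ng in H.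
  fold (half (xs 0)) in H. fold (dl A xs ⊖ half (xs 0)) in H.
  fold (half (xs 0) ⊖ dl A xs) in H.
  rewrite (proj2 (sub_eq0 _ _ _) (half_le_dl _ xs)), op_zero in H. rewrite H.
  pose proof (dl_iv A (fun n => xs (S n))) as H4. cbv beta zeta in H4.
  unfold half. rewrite <- H4. f_equal. extensionality n. now destruct n.
Qed.

Lemma dl_unfold (A : deltaAlg) (xs : nat -> A) :
  dl A xs = half (xs 0) ⊕ half (dl A (fun n => xs (S n))).
Proof. rewrite <- dl_sub_half. symmetry. apply op_sub, half_le_dl. Qed.

(** The case of a constant sequence, whose delta is [a] by axiom (iii). *)
Lemma sub_half (A : deltaAlg) (a : A) : a ⊖ half a = half a.
Proof. pose proof (dl_sub_half A (fun _ => a)) as H. now rewrite !dl_iii in H. Qed.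

Lemma half_op_half (A : deltaAlg) (a : A) : half a ⊕ half a = a.
Proof. pose proof (dl_unfold A (fun _ => a)) as H. now rewrite !dl_iii in H. Qed.

(** * Dyadic constants: [nmul k (dyad n)] stands for k/2^n truncated at 1 *)

Fixpoint dyad {A : deltaAlg} (n : nat) : A :=
  match n with 0 => 1̂ | S k => half (dyad k) end.

(** Multiples of the unit 2^-n are not truncated before the last step. In the induction, doubling
    the half units gives [¬ dyad n], and adding one more half unit gives
    [¬ (dyad n ⊖ half (dyad n))]. *)
Lemma nmul_dyad_pred (A : deltaAlg) (n : nat) : nmul (2 ^ n - 1) (dyad n) = ¬ dyad n :> A.
Proof.
  induction n as [|n IH].
  - simpl. now rewrite ng_one.
  - replace (2 ^ S n - 1) with ((2 ^ n - 1) * 2 + 1).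
    + rewrite nmul_add, nmul_mul. simpl. rewrite !op_zero, half_op_half, IH.
      rewrite <- (sub_half A (dyad n)) at 2. unfold sub. now rewrite ng_ng.
    + simpl. pose proof (Nat.pow_nonzero 2 n). lia.
Qed.

Lemma nmul_dyad_full (A : deltaAlg) (n : nat) : nmul (2 ^ n) (dyad n) = 1̂ :> A.
Proof.
  pose proof (Nat.pow_nonzero 2 n).
  replace (2 ^ n) with ((2 ^ n - 1) + 1) by lia.
  rewrite nmul_add, nmul_dyad_pred. simpl. rewrite op_zero. apply ng_op_self.
Qed.

Lemma nmul_dyad_shift (A : deltaAlg) (m n k : nat) :
  nmul k (dyad n) = nmul (k * 2 ^ m) (dyad (m + n)) :> A.
Proof.
  induction m as [|m IH]; [simpl; f_equal; lia|].
  rewrite IH. replace (k * 2 ^ S m) with (k * 2 ^ m * 2) by (simpl; lia).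
  rewrite (nmul_mul A _ 2). simpl. now rewrite op_zero, half_op_half.
Qed.

(** One unit is removed at a time. Past 2^n the natural subtraction stops at 0, just as the multiple
    stops at 1. *)
Lemma ng_nmul_dyad (A : deltaAlg) (n k : nat) :
  ¬ nmul k (dyad n) = nmul (2 ^ n - k) (dyad n) :> A.
Proof.
  induction k as [|k IH].
  - simpl. now rewrite Nat.sub_0_r, nmul_dyad_full.
  - replace (¬ nmul (S k) (dyad n)) with (¬ nmul k (dyad n) ⊖ dyad n : A).
    + rewrite IH. destruct (Nat.le_gt_cases (2 ^ n) k) as [H|H].
      * replace (2 ^ n - k) with 0 by lia. replace (2 ^ n - S k) with 0 by lia.
        apply sub_eq0, zero_le.
      * replace (2 ^ n - k) with (S (2 ^ n - S k)) by lia. simpl.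
        rewrite op_comm. apply op_subK. rewrite <- nmul_dyad_pred. apply nmul_le. lia.
    + unfold sub. rewrite ng_ng. simpl. now rewrite op_comm.
Qed.

Lemma nmul_dyad_step (A : deltaAlg) (n k : nat) : k < 2 ^ n ->
  nmul (S k) (dyad n) ⊖ nmul k (dyad n) = dyad n :> A.
Proof.
  intros H. unfold sub.
  rewrite ng_nmul_dyad, <- nmul_add. replace (2 ^ n - S k + k) with (2 ^ n - 1) by lia.
  now rewrite nmul_dyad_pred, ng_ng.
Qed.

(** * Ideals of terms modulo a theory *)

Section Ideals.
Context {V : Type}.
Implicit Types (s t u : term V) (T : theory V) (M G : term V -> Prop).

(** Mirrors [sub], so that its evaluation is convertible to [sub] of the evaluations. *)
Definition Tsub s t : term V := Tneg (Toplus (Tneg s) t).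

Definition Thalf t : term V := Tdelta (fun n => match n with 0 => t | _ => Tzero end).

Fixpoint Tmul (n : nat) t : term V :=
  match n with 0 => Tzero | S k => Toplus t (Tmul k t) end.

Fixpoint Tunit (n : nat) : term V :=
  match n with 0 => Tone | S k => Thalf (Tunit k) end.

Definition Tdyad (n k : nat) : term V := Tmul k (Tunit n).

Lemma eval_Tmul (A : deltaAlg) (f : V -> A) (n : nat) t :
  eval A f (Tmul n t) = nmul n (eval A f t).
Proof. induction n as [|n IH]; simpl; [easy | now rewrite IH]. Qed.

Lemma eval_Thalf (A : deltaAlg) (f : V -> A) t : eval A f (Thalf t) = half (eval A f t).
Proof. simpl. unfold half. f_equal. extensionality n. now destruct n. Qed.

Lemma eval_Tdyad (A : deltaAlg) (f : V -> A) (n k : nat) :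
  eval A f (Tdyad n k) = nmul k (dyad n).
Proof.
  unfold Tdyad. rewrite eval_Tmul. f_equal.
  induction n as [|n IH]; [easy|].
  change (Tunit (S n)) with (Thalf (Tunit n)). now rewrite eval_Thalf, IH.
Qed.

(** The order of the algebra of terms modulo [T], stated on terms so that no quotient has to be
    formed. *)
Definition tle T s t : Prop :=
  forall (A : deltaAlg) (f : V -> A), models A f T -> mv_le (eval A f s) (eval A f t).

Lemma tle_trans T s t u : tle T s t -> tle T t u -> tle T s u.
Proof. intros H1 H2 A f Hf. apply le_trans with (eval A f t); auto. Qed.

Lemma entails_tle T s t : entails T (s, t) -> tle T s t.
Proof. intros H A f Hf. apply le_eq. exact (H A f Hf). Qed.

Lemma entails_sym T s t : entails T (s, t) -> entails T (t, s).
Proof. intros H A f Hf. symmetry. exact (H A f Hf). Qed.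

Lemma tle_Tone_entails T t : tle T Tone t -> entails T (t, Tone).
Proof. intros H A f Hf. apply le_antisym; [apply le_one | exact (H A f Hf)]. Qed.

Record ideal T M : Prop := Ideal {
  ideal_add : forall [s t], M s -> M t -> M (Toplus s t);
  ideal_down : forall [s t], M t -> tle T s t -> M s;
  ideal_proper : ~ M Tone
}.

(** Maximality in its algebraic form: whatever lies outside [M] has a multiple that is 1 modulo
    [M]. *)
Record maximal_ideal T M : Prop := MaximalIdeal {
  maximal_ideal_ideal :> ideal T M;
  maximal_ideal_zero : M Tzero;
  maximal_ideal_compl : forall t, ~ M t -> exists n, M (Tneg (Tmul n t))
}.

Lemma ideal_Tmul [T M] n [t] : ideal T M -> M Tzero -> M t -> M (Tmul n t).
Proof. intros HM H0 Ht. induction n; simpl; [exact H0 | now apply (ideal_add HM)]. Qed.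

Lemma exists_maximal_ideal T G :
  G Tzero ->
  (forall s t, G s -> G t -> G (Toplus s t)) ->
  (forall t, G t -> ~ entails T (t, Tone)) ->
  exists M, maximal_ideal T M /\ (forall t, G t -> M t).
Proof.
  intros G0 Gadd Gproper.
  (* Guarding [G ⊆ M] by nonemptiness of [M] makes the union of the empty chain admissible. *)
  pose (P := fun M => ideal T M /\ forall s, M s -> forall g, G g -> M g).
  destruct (@classical_sets.Zorn_bigcup (term V) P) as [M [[HM HG] Hmax]].
  { intros F FP Ftot. split; [split|].
    - intros s t [B FB Bs] [C FC Ct].
      destruct (Ftot B C FB FC) as [H|H].
      + exists C; [exact FC|]. exact (ideal_add (proj1 (FP C FC)) (H s Bs) Ct).
      + exists B; [exact FB|]. exact (ideal_add (proj1 (FP B FB)) Bs (H t Ct)).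
    - intros s t [B FB Bt] Hst. exists B; [exact FB|].
      exact (ideal_down (proj1 (FP B FB)) Bt Hst).
    - intros [B FB B1]. exact (ideal_proper (proj1 (FP B FB)) B1).
    - intros s [B FB Bs] g Gg. exists B; [exact FB|]. exact (proj2 (FP B FB) s Bs g Gg). }
  assert (Hext : forall N : term V -> Prop, P N -> (forall s, M s -> N s) -> forall s, N s -> M s).
  { intros N HN HMN. apply NNPP. intros Hnot. apply (Hmax N); [|exact HN].
    split; [exact HMN | exact Hnot]. }
  assert (H0 : exists s, M s).
  { apply NNPP. intros Hempty. apply Hempty. exists Tzero.
    (* If [M] were empty, the ideal generated by [G] would extend it. *)
    apply (Hext (fun s => exists g, G g /\ tle T s g)).
    - split; [split|].
      + intros s t [g [Gg Hg]] [k [Gk Hk]]. exists (Toplus g k). split; [now apply Gadd|].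
        intros A f Hf. simpl. apply op_le; auto.
      + intros s t [g [Gg Hg]] Hst. exists g. split; [exact Gg|]. now apply tle_trans with t.
      + intros [g [Gg Hg]]. apply (Gproper g Gg). now apply tle_Tone_entails.
      + intros _ _ g Gg. exists g. split; [exact Gg|]. intros A f _. apply le_refl.
    - intros s Hs. exfalso. eauto.
    - exists Tzero. split; [exact G0|]. intros A f _. apply le_refl. }
  destruct H0 as [s0 Hs0]. pose proof (HG s0 Hs0) as HGM.
  pose proof (HGM _ G0) as HM0.
  exists M. split; [split|]; [exact HM | exact HM0 | | exact HGM].
  intros t Ht. apply NNPP. intros Hno. apply Ht.
  (* The ideal generated by [M] and [t] is proper: [Tone] below [n t ⊕ m] would put [¬ (n t)] below
     [m], hence into [M]. By maximality it is contained in [M], so [t] is in [M]. *)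
  apply (Hext (fun s => exists n m, M m /\ tle T s (Toplus (Tmul n t) m))).
  - split; [split|].
    + intros s u [n [m [Mm Hm]]] [n' [m' [Mm' Hm']]].
      exists (n + n'), (Toplus m m'). split; [now apply (ideal_add HM)|].
      intros A f Hf. pose proof (Hm A f Hf) as E. pose proof (Hm' A f Hf) as E'.
      simpl in *. rewrite eval_Tmul in *. rewrite nmul_add, op_ACA. now apply op_le.
    + intros s u [n [m [Mm Hm]]] Hsu. exists n, m. split; [exact Mm|]. now apply tle_trans with u.
    + intros [n [m [Mm Hm]]]. apply Hno. exists n. apply (ideal_down HM Mm).
      intros A f Hf. pose proof (Hm A f Hf) as E. simpl in *.
      unfold mv_le in *. now rewrite ng_ng, zero_op in *.
    + intros _ _ g Gg. exists 0, g. split; [now apply HGM|].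
      intros A f _. simpl. rewrite zero_op. apply le_refl.
  - intros s Hs. exists 0, s. split; [exact Hs|].
    intros A f _. simpl. rewrite zero_op. apply le_refl.
  - exists 1, Tzero. split; [exact HM0|].
    intros A f _. simpl. rewrite !op_zero. apply le_refl.
Qed.

(** If neither difference were in [M], negated multiples of both would be, and their sum is 1 by
    [sub_nmul_ng]. *)
Lemma maximal_ideal_total T M s t : maximal_ideal T M -> M (Tsub s t) \/ M (Tsub t s).
Proof.
  intros HM. destruct (classic (M (Tsub s t))) as [H|H]; [now left|].
  destruct (classic (M (Tsub t s))) as [H'|H']; [now right|].
  exfalso. destruct (maximal_ideal_compl HM _ H) as [n Hn].
  destruct (maximal_ideal_compl HM _ H') as [m Hm].
  apply (ideal_proper HM). apply (ideal_down HM (ideal_add HM Hn Hm)).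
  intros A f _. simpl. rewrite !eval_Tmul. simpl.
  apply le_eq. symmetry. apply (sub_nmul_ng A n m (eval A f s) (eval A f t)).
Qed.

Lemma ideal_sub_trans [T M s t u] :
  ideal T M -> M (Tsub s t) -> M (Tsub t u) -> M (Tsub s u).
Proof.
  intros HM H1 H2. apply (ideal_down HM (ideal_add HM H1 H2)).
  intros A f _. apply sub_triangle.
Qed.

Lemma ideal_sub_tle T M s t : ideal T M -> M Tzero -> tle T s t -> M (Tsub s t).
Proof.
  intros HM H0 H. apply (ideal_down HM H0). intros A f Hf.
  apply le_eq. apply (sub_eq0 A). exact (H A f Hf).
Qed.

(** * The real number determined by a maximal ideal *)

Lemma eq_of_dyadic_close (C x y : R) :
  (forall n, Rabs (x - y) <= C / 2 ^ n)%R -> x = y.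
Proof.
  intros H. apply Rminus_diag_uniq, NNPP. intros Hne.
  pose proof (Rabs_pos_lt _ Hne) as Hpos.
  (* The bound at [n = 0] forces [C] to be positive. *)
  pose proof (H 0) as H0. simpl in H0.
  assert (HC : (0 < C)%R) by lra.
  assert (Hd : (0 < Rabs (x - y) / C)%R) by (apply Rdiv_lt_0_compat; lra).
  destruct (pow_lt_1_zero (/ 2) ltac:(rewrite Rabs_right; lra) _ Hd) as [N HN].
  specialize (HN N (le_n N)). specialize (H N).
  rewrite pow_inv, Rabs_right in HN.
  - apply (Rmult_lt_compat_l C) in HN; [|exact HC].
    replace (C * (Rabs (x - y) / C))%R with (Rabs (x - y)) in HN by (field; lra).
    unfold Rdiv in H. lra.
  - apply Rle_ge, Rlt_le, Rinv_0_lt_compat, pow_lt. lra.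
Qed.

Lemma INR_pow2 n : INR (2 ^ n) = (2 ^ n)%R.
Proof. rewrite pow_INR. reflexivity. Qed.

Definition dyadR (n k : nat) : R := (INR k / 2 ^ n)%R.

Lemma pow2_pos n : (0 < 2 ^ n)%R.
Proof. apply pow_lt; lra. Qed.

Lemma dyadR_add n j k : dyadR n (j + k) = (dyadR n j + dyadR n k)%R.
Proof. unfold dyadR. rewrite plus_INR. lra. Qed.

Lemma dyadR_pos n k : (0 <= dyadR n k)%R.
Proof. apply Rle_mult_inv_pos; [apply pos_INR | apply pow2_pos]. Qed.

Lemma dyadR_full n : dyadR n (2 ^ n) = 1%R.
Proof. unfold dyadR. rewrite INR_pow2. field. pose proof (pow2_pos n). lra. Qed.

Lemma dyadR_compl n k : k <= 2 ^ n -> dyadR n (2 ^ n - k) = (1 - dyadR n k)%R.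
Proof.
  intros H. pose proof (dyadR_add n (2 ^ n - k) k) as E.
  rewrite Nat.sub_add, dyadR_full in E by exact H. lra.
Qed.

(* [r] separates the dyadic constants below [t] from those above it, modulo [M];
   the constants [Tdyad n k] with [2 ^ n < k] are truncated to 1. *)
Definition cut M t (r : R) : Prop :=
  forall n k,
    (M (Tsub (Tdyad n k) t) -> Rmin 1 (dyadR n k) <= r)%R /\
    (M (Tsub t (Tdyad n k)) -> r <= dyadR n k)%R.

(** Otherwise, over the common denominator 2^(n+m), the difference is at least one unit; [M] then
    contains that unit and its multiple 1. *)
Lemma ideal_dyad_order T M n k m j : ideal T M -> M Tzero ->
  M (Tsub (Tdyad n k) (Tdyad m j)) -> (Rmin 1 (dyadR n k) <= dyadR m j)%R.
Proof.
  intros HM H0 H. apply Rnot_lt_le. intros Hlt.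
  assert (H1 : (dyadR m j < 1)%R) by (eapply Rlt_le_trans; [exact Hlt | apply Rmin_l]).
  assert (H2 : (dyadR m j < dyadR n k)%R) by (eapply Rlt_le_trans; [exact Hlt | apply Rmin_r]).
  pose proof (pow2_pos n) as Pn. pose proof (pow2_pos m) as Pm.
  unfold dyadR in *.
  assert (K1 : (j * 2 ^ n < 2 ^ (n + m))%nat).
  { apply INR_lt. rewrite mult_INR, !INR_pow2, pow_add.
    apply (Rmult_lt_compat_r (2 ^ m * 2 ^ n)) in H1; [|now apply Rmult_lt_0_compat].
    field_simplify in H1; lra. }
  assert (K2 : (j * 2 ^ n < k * 2 ^ m)%nat).
  { apply INR_lt. rewrite !mult_INR, !INR_pow2.
    apply (Rmult_lt_compat_r (2 ^ m * 2 ^ n)) in H2; [|now apply Rmult_lt_0_compat].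
    field_simplify in H2; lra. }
  assert (Hu : M (Tdyad (n + m) 1)).
  { apply (ideal_down HM H). intros A f _.
    change (mv_le (eval A f (Tdyad (n + m) 1))
                  (sub (eval A f (Tdyad n k)) (eval A f (Tdyad m j)))).
    rewrite !eval_Tdyad, (nmul_dyad_shift A m n), (nmul_dyad_shift A n m).
    rewrite (Nat.add_comm m n). simpl. rewrite op_zero.
    rewrite <- (nmul_dyad_step A _ K1) at 1.
    apply sub_mono; [now apply nmul_le | apply le_refl]. }
  apply (ideal_proper HM). apply (ideal_down HM (ideal_Tmul (2 ^ (n + m)) HM H0 Hu)).
  intros A f _. rewrite eval_Tmul, eval_Tdyad. simpl. rewrite op_zero, nmul_dyad_full.
  apply le_refl.
Qed.

(** The supremum of the truncated dyadic constants below [t] is a cut; every constant above [t]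
    bounds them by transitivity and [ideal_dyad_order]. *)
Lemma cut_exists T M t : ideal T M -> M Tzero -> exists r, cut M t r.
Proof.
  intros HM H0.
  pose (E := fun x => exists n k, M (Tsub (Tdyad n k) t) /\ x = Rmin 1 (dyadR n k)).
  destruct (completeness E) as [r [Hub Hlub]].
  - exists 1%R. intros x [n [k [_ ->]]]. apply Rmin_l.
  - exists (Rmin 1 (dyadR 0 0)), 0, 0. split; [|reflexivity].
    apply (ideal_sub_tle HM H0). intros A f _. apply zero_le.
  - exists r. intros n k. split.
    + intros H. apply Hub. exists n, k. now split.
    + intros H. apply Hlub. intros x [m [j [Hj ->]]].
      apply (ideal_dyad_order m j n k HM H0). exact (ideal_sub_trans HM Hj H).
Qed.

Lemma cut_range T M t r : ideal T M -> M Tzero -> cut M t r -> (0 <= r <= 1)%R.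
Proof.
  intros HM H0 Hr. split.
  - apply Rle_trans with (Rmin 1 (dyadR 0 0)).
    + apply Rmin_glb; [lra | apply dyadR_pos].
    + apply (Hr 0 0). apply (ideal_sub_tle HM H0). intros A f _. apply zero_le.
  - rewrite <- (dyadR_full 0). apply (Hr 0 (2 ^ 0)).
    apply (ideal_sub_tle HM H0). intros A f _. rewrite eval_Tdyad, nmul_dyad_full.
    apply le_one.
Qed.

(** Without a bracket, totality would carry the lower bound from [k] to [k + 1] all the way to 2^n,
    where the constant is 1 and does lie above [t]. *)
Lemma maximal_ideal_bracket T M t n : maximal_ideal T M ->
  exists k, k < 2 ^ n /\ M (Tsub (Tdyad n k) t) /\ M (Tsub t (Tdyad n (S k))).
Proof.
  intros HM. pose proof (maximal_ideal_zero HM) as H0.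
  assert (Hfull : M (Tsub t (Tdyad n (2 ^ n)))).
  { apply (ideal_sub_tle HM H0). intros A f _. rewrite eval_Tdyad, nmul_dyad_full.
    apply le_one. }
  apply NNPP. intros Hno.
  (* The guard [0 < k] is there because [t] itself may belong to [M]. *)
  assert (Hall : forall k, k <= 2 ^ n -> M (Tsub (Tdyad n k) t) /\ (0 < k -> ~ M (Tsub t (Tdyad n k)))).
  { induction k as [|k IH]; intros Hk.
    - split; [|lia]. apply (ideal_sub_tle HM H0). intros A f _. apply zero_le.
    - assert (Hn : ~ M (Tsub t (Tdyad n (S k)))).
      { intros Hc. apply Hno. exists k. repeat split; [lia | apply IH; lia | exact Hc]. }
      split; [|auto].
      destruct (maximal_ideal_total (Tdyad n (S k)) t HM) as [H|H]; [exact H | easy]. }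
  apply (Hall (2 ^ n)); [lia | | exact Hfull].
  pose proof (Nat.pow_nonzero 2 n). lia.
Qed.

Lemma cut_bracket T M t r n : maximal_ideal T M -> cut M t r ->
  exists k, k < 2 ^ n /\ M (Tsub (Tdyad n k) t) /\ M (Tsub t (Tdyad n (S k))) /\
    (dyadR n k <= r <= dyadR n k + / 2 ^ n)%R.
Proof.
  intros HM Hr. destruct (maximal_ideal_bracket t n HM) as [k [Hk [H1 H2]]].
  exists k. repeat split; auto.
  - apply Rle_trans with (Rmin 1 (dyadR n k)); [|now apply Hr].
    apply Rmin_glb; [|lra]. rewrite <- (dyadR_full n).
    unfold dyadR. apply Rmult_le_compat_r; [|apply le_INR; lia].
    apply Rlt_le, Rinv_0_lt_compat, pow2_pos.
  - apply Rle_trans with (dyadR n (S k)); [now apply Hr|].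
    unfold dyadR. rewrite S_INR. unfold Rdiv. lra.
Qed.

Lemma cut_unique T M t r q : maximal_ideal T M -> cut M t r -> cut M t q -> r = q.
Proof.
  intros HM Hr Hq. apply eq_of_dyadic_close with 1%R. intros n.
  destruct (cut_bracket n HM Hr) as [k [_ [H1 [H2 Hk]]]].
  destruct (Hq n k) as [Q1 _]. destruct (Hq n (S k)) as [_ Q2].
  specialize (Q1 H1). specialize (Q2 H2).
  destruct (cut_range HM (maximal_ideal_zero HM) Hr) as [R0 R1].
  rewrite Rmin_right in Q1 by lra.
  unfold dyadR in *. rewrite S_INR in Q2. unfold Rdiv in *.
  apply Rabs_le. lra.
Qed.

Lemma cut_tle T M s t r : ideal T M -> M Tzero ->
  tle T s t -> tle T t s -> cut M s r -> cut M t r.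
Proof.
  intros HM H0 Hst Hts Hr n k.
  pose proof (ideal_sub_tle HM H0 Hst). pose proof (ideal_sub_tle HM H0 Hts).
  split; intros H'; apply (Hr n k); eapply ideal_sub_trans; eauto.
Qed.

Lemma cut_zero T M : ideal T M -> M Tzero -> cut M Tzero 0%R.
Proof.
  intros HM H0 n k. split; [|intros _; apply dyadR_pos].
  (* [Tzero] is convertible to [Tdyad 0 0]. *)
  intros H. replace 0%R with (dyadR 0 0) by (unfold dyadR; simpl; lra).
  exact (ideal_dyad_order n k 0 0 HM H0 H).
Qed.

(** Negation reverses the order and sends [Tdyad n k] to [Tdyad n (2 ^ n - k)]. For [k] beyond 2^n
    the latter is 0, so that case is treated apart. *)
Lemma cut_neg T M t r : ideal T M -> M Tzero -> cut M t r -> cut M (Tneg t) (1 - r)%R.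
Proof.
  intros HM H0 Hr n k. destruct (Hr n (2 ^ n - k)) as [L U].
  destruct (cut_range HM H0 Hr) as [R0 R1]. split; intros H.
  - assert (Hr' : (r <= dyadR n (2 ^ n - k))%R).
    { apply U. apply (ideal_down HM H). intros A f _.
      change (mv_le (sub (eval A f t) (eval A f (Tdyad n (2 ^ n - k))))
                    (sub (eval A f (Tdyad n k)) (ng A (eval A f t)))).
      rewrite !eval_Tdyad, <- ng_nmul_dyad, <- (sub_ng A (ng A (eval A f t))), ng_ng.
      apply le_refl. }
    destruct (Nat.le_gt_cases k (2 ^ n)) as [Hk|Hk].
    + rewrite dyadR_compl in Hr' by exact Hk. apply Rle_trans with (1 := Rmin_r _ _). lra.
    + replace (2 ^ n - k) with 0 in Hr' by lia. unfold dyadR at 1 in Hr'. simpl in Hr'.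
      apply Rle_trans with (1 := Rmin_l _ _). lra.
  - destruct (Nat.le_gt_cases k (2 ^ n)) as [Hk|Hk].
    + assert (Hr' : (Rmin 1 (dyadR n (2 ^ n - k)) <= r)%R).
      { apply L. apply (ideal_down HM H). intros A f _.
        change (mv_le (sub (eval A f (Tdyad n (2 ^ n - k))) (eval A f t))
                      (sub (ng A (eval A f t)) (eval A f (Tdyad n k)))).
        rewrite !eval_Tdyad, <- ng_nmul_dyad, <- (sub_ng A (nmul k (dyad n))), ng_ng.
        apply le_refl. }
      rewrite dyadR_compl in Hr' by exact Hk. pose proof (dyadR_pos n k).
      rewrite Rmin_right in Hr' by lra. lra.
    + apply Rle_trans with 1%R; [lra|]. rewrite <- (dyadR_full n).
      unfold dyadR. apply Rmult_le_compat_r; [|apply le_INR; lia].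
      apply Rlt_le, Rinv_0_lt_compat, pow2_pos.
Qed.

(** The brackets of [s] and [t] at level [n] add up to one of width 2/2^n for the sum, whence the
    constant 2; truncation of its lower end produces the minimum. *)
Lemma cut_add T M s t r q p : maximal_ideal T M ->
  cut M s r -> cut M t q -> cut M (Toplus s t) p -> p = Rmin 1 (r + q).
Proof.
  intros HM Hr Hq Hp. apply eq_of_dyadic_close with 2%R. intros n.
  destruct (cut_bracket n HM Hr) as [k [_ [K1 [K2 Hk]]]].
  destruct (cut_bracket n HM Hq) as [j [_ [J1 [J2 Hj]]]].
  destruct (cut_range HM (maximal_ideal_zero HM) Hp) as [P0 P1].
  assert (Hdyad : forall a b (A : deltaAlg) (f : V -> A), eval A f (Tdyad n (a + b)) =
                    op A (eval A f (Tdyad n a)) (eval A f (Tdyad n b))).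
  { intros a b A f. rewrite !eval_Tdyad. apply nmul_add. }
  assert (L : (Rmin 1 (dyadR n (k + j)) <= p)%R).
  { apply Hp. apply (ideal_down HM (ideal_add HM K1 J1)). intros A f _.
    change (mv_le (sub (eval A f (Tdyad n (k + j))) (op A (eval A f s) (eval A f t)))
                  (op A (sub (eval A f (Tdyad n k)) (eval A f s))
                        (sub (eval A f (Tdyad n j)) (eval A f t)))).
    rewrite Hdyad. apply op_sub_op. }
  assert (U : (p <= dyadR n (S k + S j))%R).
  { apply Hp. apply (ideal_down HM (ideal_add HM K2 J2)). intros A f _.
    change (mv_le (sub (op A (eval A f s) (eval A f t)) (eval A f (Tdyad n (S k + S j))))
                  (op A (sub (eval A f s) (eval A f (Tdyad n (S k))))
                        (sub (eval A f t) (eval A f (Tdyad n (S j)))))).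
    rewrite Hdyad. apply op_sub_op. }
  rewrite dyadR_add in L, U.
  assert (HS : forall i, dyadR n (S i) = (dyadR n i + / 2 ^ n)%R).
  { intros i. unfold dyadR. rewrite S_INR. unfold Rdiv. lra. }
  rewrite !HS in U. unfold Rdiv. pose proof (Rinv_0_lt_compat _ (pow2_pos n)).
  apply Rabs_le. revert L. unfold Rmin. repeat destruct Rle_dec; lra.
Qed.

Lemma maximal_ideal_valuation T M : maximal_ideal T M ->
  exists h : term V -> R, forall t, cut M t (h t).
Proof.
  intros HM. exists (fun t => epsilon (inhabits 0%R) (cut M t)). intros t.
  apply epsilon_spec. exact (cut_exists t HM (maximal_ideal_zero HM)).
Qed.

(* The identity [t ⊖ half t = half t] alone forces this. *)
Lemma cut_half T M t r q : maximal_ideal T M ->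
  cut M t r -> cut M (Thalf t) q -> q = (r / 2)%R.
Proof.
  intros HM Hr Hq. pose proof (maximal_ideal_zero HM) as H0.
  destruct (cut_exists (Toplus (Tneg t) (Thalf t)) HM H0) as [p Hp].
  pose proof (cut_add HM (cut_neg HM H0 Hr) Hq Hp) as Hadd.
  assert (Heq : q = (1 - p)%R).
  { apply (cut_unique HM Hq). refine (cut_tle HM H0 _ _ (cut_neg HM H0 Hp));
    intros A f _; apply le_eq; change (eval A f (Tneg (Toplus (Tneg t) (Thalf t)))) with
      (sub (eval A f t) (eval A f (Thalf t))); rewrite eval_Thalf, sub_half; reflexivity. }
  destruct (cut_range HM H0 Hr). destruct (cut_range HM H0 Hq).
  revert Hadd. unfold Rmin. destruct Rle_dec; lra.
Qed.

Lemma cut_dl T M (ts : nat -> term V) r q p : maximal_ideal T M ->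
  cut M (ts 0) r -> cut M (Tdelta (fun n => ts (S n))) q -> cut M (Tdelta ts) p ->
  p = (r / 2 + q / 2)%R.
Proof.
  intros HM Hr Hq Hp. pose proof (maximal_ideal_zero HM) as H0.
  destruct (cut_exists (Thalf (ts 0)) HM H0) as [r' Hr'].
  destruct (cut_exists (Thalf (Tdelta (fun n => ts (S n)))) HM H0) as [q' Hq'].
  rewrite <- (cut_half HM Hr Hr'), <- (cut_half HM Hq Hq').
  assert (Hp' : cut M (Toplus (Thalf (ts 0)) (Thalf (Tdelta (fun n => ts (S n))))) p).
  { refine (cut_tle HM H0 _ _ Hp); intros A f _; apply le_eq;
    change (eval A f (Toplus (Thalf (ts 0)) (Thalf (Tdelta (fun n => ts (S n))))))
      with (op A (eval A f (Thalf (ts 0))) (eval A f (Thalf (Tdelta (fun n => ts (S n))))));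
    rewrite !eval_Thalf; [|symmetry]; exact (dl_unfold A (fun n => eval A f (ts n))). }
  (* Each half is at most 1/2, so the sum is not truncated. *)
  rewrite (cut_add HM Hr' Hq' Hp'). apply Rmin_right.
  pose proof (cut_half HM Hr Hr'). pose proof (cut_half HM Hq Hq').
  destruct (cut_range HM H0 Hr). destruct (cut_range HM H0 Hq). lra.
Qed.

End Ideals.

(** * The standard delta-algebra on the unit interval *)

(** The weight 2^-(n+1) is written as a constant times a geometric term, to match the series
    lemmas. *)
Definition dsum (xs : nat -> R) : R := Series (fun n => xs n * (/ 2 * (/ 2) ^ n))%R.

Lemma ex_series_half : ex_series (fun n => / 2 * (/ 2) ^ n)%R.
Proof.
  apply (ex_series_scal (/ 2)%R (fun n => (/ 2) ^ n)%R), ex_series_geom.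
  rewrite Rabs_right; lra.
Qed.

Lemma half_pow_pos n : (0 < / 2 * (/ 2) ^ n)%R.
Proof. apply Rmult_lt_0_compat; [lra | apply pow_lt; lra]. Qed.

Lemma ex_dsum (xs : nat -> R) : (forall n, 0 <= xs n <= 1)%R ->
  ex_series (fun n => xs n * (/ 2 * (/ 2) ^ n))%R.
Proof.
  intros H. refine (ex_series_le _ _ _ ex_series_half). intros n.
  change (Rabs (xs n * (/ 2 * (/ 2) ^ n)) <= / 2 * (/ 2) ^ n)%R.
  pose proof (half_pow_pos n). destruct (H n).
  rewrite Rabs_right; [nra | apply Rle_ge, Rmult_le_pos; lra].
Qed.

Lemma dsum_const x : dsum (fun _ => x) = x.
Proof.
  unfold dsum. rewrite (Series_scal_l x), (Series_scal_l (/ 2)%R), Series_geom.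
  - field.
  - rewrite Rabs_right; lra.
Qed.

Lemma dsum_ext (xs ys : nat -> R) : (forall n, xs n = ys n) -> dsum xs = dsum ys.
Proof. intros H. apply Series_ext. intros n. now rewrite H. Qed.

Lemma dsum_le (xs ys : nat -> R) :
  (forall n, 0 <= xs n <= ys n)%R -> (forall n, ys n <= 1)%R -> (dsum xs <= dsum ys)%R.
Proof.
  intros H H'. apply Series_le.
  - intros n. pose proof (half_pow_pos n). destruct (H n). split.
    + apply Rmult_le_pos; lra.
    + apply Rmult_le_compat_r; lra.
  - apply ex_dsum. intros n. destruct (H n). specialize (H' n). lra.
Qed.

Lemma dsum_range (xs : nat -> R) : (forall n, 0 <= xs n <= 1)%R -> (0 <= dsum xs <= 1)%R.
Proof.
  intros H. split.
  - rewrite <- (dsum_const 0). apply dsum_le; intros n; destruct (H n); lra.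
  - rewrite <- (dsum_const 1). apply dsum_le; intros n; destruct (H n); lra.
Qed.

Lemma dsum_unfold (xs : nat -> R) : (forall n, 0 <= xs n <= 1)%R ->
  dsum xs = (xs 0%nat / 2 + dsum (fun n => xs (S n)) / 2)%R.
Proof.
  intros H. unfold dsum. rewrite Series_incr_1 by now apply ex_dsum.
  replace (xs 0%nat * (/ 2 * (/ 2) ^ 0))%R with (xs 0%nat / 2)%R by (simpl; field).
  f_equal. unfold Rdiv. rewrite Rmult_comm, <- Series_scal_l.
  apply Series_ext. intros n. simpl. ring.
Qed.

Lemma dsum_half (xs : nat -> R) : dsum (fun n => xs n / 2)%R = (dsum xs / 2)%R.
Proof.
  unfold dsum, Rdiv. rewrite (Rmult_comm (Series _)), <- Series_scal_l.
  apply Series_ext. intros n. ring.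
Qed.

(** The sums of the tails of [xs] obey the same recursion as [r]. Each step halves the difference of
    the two, which is at most 1 throughout. *)
Lemma dsum_unique (xs r : nat -> R) :
  (forall n, 0 <= xs n <= 1)%R -> (forall n, 0 <= r n <= 1)%R ->
  (forall n, r n = xs n / 2 + r (S n) / 2)%R -> r 0 = dsum xs.
Proof.
  intros Hxs Hr Hrec. apply eq_of_dyadic_close with 1%R. intros n.
  assert (Hn : (Rabs (r 0%nat - dsum xs) = Rabs (r n - dsum (fun k => xs (n + k)%nat)) / 2 ^ n)%R).
  { induction n as [|n IH].
    - simpl. unfold Rdiv. now rewrite Rinv_1, Rmult_1_r.
    - rewrite IH, Hrec, dsum_unfold by auto. rewrite Nat.add_0_r.
      rewrite (dsum_ext (fun k => xs (n + S k)) (fun k => xs (S n + k)))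
        by (intros k; f_equal; lia).
      set (d := dsum _).
      replace (xs n / 2 + r (S n) / 2 - (xs n / 2 + d / 2))%R with ((r (S n) - d) * / 2)%R by field.
      rewrite Rabs_mult, (Rabs_right (/ 2)%R) by lra.
      simpl. field. apply pow_nonzero. lra. }
  rewrite Hn. apply Rmult_le_compat_r.
  - apply Rlt_le, Rinv_0_lt_compat, pow_lt. lra.
  - destruct (Hr n). assert (Hs : forall k, (0 <= xs (n + k)%nat <= 1)%R) by auto.
    apply dsum_range in Hs. apply Rabs_le. lra.
Qed.

Definition unitI : Type := {x : R | (0 <= x <= 1)%R}.

Lemma unitI_eq (x y : unitI) : proj1_sig x = proj1_sig y -> x = y.
Proof.
  destruct x as [x Hx], y as [y Hy]. simpl. intros <-. f_equal. apply proof_irrelevance.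
Qed.

Definition unitI_dl (xs : nat -> unitI) : unitI :=
  exist _ (dsum (fun n => proj1_sig (xs n))) (dsum_range _ (fun n => proj2_sig (xs n))).

Lemma Rmin_unitI (x y : unitI) : (0 <= Rmin 1 (proj1_sig x + proj1_sig y) <= 1)%R.
Proof.
  destruct x as [x Hx], y as [y Hy]. simpl. unfold Rmin. destruct Rle_dec; lra.
Qed.

Definition unitI_op (x y : unitI) : unitI := exist _ _ (Rmin_unitI x y).

Lemma compl_unitI (x : unitI) : (0 <= 1 - proj1_sig x <= 1)%R.
Proof. destruct x as [x Hx]. simpl. lra. Qed.

Definition unitI_ng (x : unitI) : unitI := exist _ _ (compl_unitI x).

Definition unitI_zr : unitI := exist _ 0%R (conj (Rle_refl 0) Rle_0_1).

Definition unitI_half (x : unitI) : unitI :=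
  unitI_dl (fun n => match n with 0 => x | _ => unitI_zr end).

Lemma unitI_dl_unfold (xs : nat -> unitI) :
  proj1_sig (unitI_dl xs) =
  (proj1_sig (xs 0%nat) / 2 + proj1_sig (unitI_dl (fun n => xs (S n))) / 2)%R.
Proof. apply (dsum_unfold (fun n => proj1_sig (xs n))). intros n. apply proj2_sig. Qed.

Lemma unitI_dl_const (x : unitI) : unitI_dl (fun _ => x) = x.
Proof. apply unitI_eq. apply dsum_const. Qed.

Lemma unitI_halfE (x : unitI) : proj1_sig (unitI_half x) = (proj1_sig x / 2)%R.
Proof. unfold unitI_half. rewrite unitI_dl_unfold, unitI_dl_const. simpl. lra. Qed.

Definition unitI_deltaAlg : deltaAlg.
Proof.
  refine (@DeltaAlg unitI unitI_dl unitI_op unitI_ng unitI_zr _ _ _ _ _ _ _ _ _ _ _ _).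
  - intros [a Ha] [b Hb] [c Hc]. apply unitI_eq. simpl.
    unfold Rmin. repeat destruct Rle_dec; lra.
  - intros [a Ha] [b Hb]. apply unitI_eq. simpl. f_equal. lra.
  - intros [a Ha]. apply unitI_eq. simpl. unfold Rmin. destruct Rle_dec; lra.
  - intros [a Ha]. apply unitI_eq. simpl. lra.
  - intros [a Ha]. apply unitI_eq. simpl. unfold Rmin. destruct Rle_dec; lra.
  - intros [a Ha] [b Hb]. apply unitI_eq. simpl.
    unfold Rmin. repeat destruct Rle_dec; lra.
  - intros xs. fold (unitI_half (xs 0)). cbv beta zeta. apply unitI_eq.
    (* With [t] the delta of the tail, the axiom becomes a linear statement about [t], [xs 0],
       [a = xs 0 / 2 + t / 2] and [b = xs 0 / 2]. *)
    rewrite (unitI_dl_unfold (fun n => match n with 0 => unitI_zr | _ => xs n end)).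
    pose proof (unitI_dl_unfold xs) as E. pose proof (unitI_halfE (xs 0)) as E0.
    pose proof (proj2_sig (unitI_dl (fun n => xs (S n)))) as Ht. cbv beta in Ht.
    pose proof (proj2_sig (xs 0)) as H0. cbv beta in H0.
    set (t := unitI_dl (fun n => xs (S n))) in *.
    set (a := unitI_dl xs) in *. set (b := unitI_half (xs 0)) in *.
    clearbody t a b. destruct t as [t ?], a as [a ?], b as [b ?]. simpl in *.
    unfold Rmin. repeat destruct Rle_dec; lra.
  - intros xs half. apply unitI_eq. change half with unitI_half. rewrite unitI_halfE.
    simpl. rewrite <- dsum_half. apply dsum_ext. intros n. symmetry. apply unitI_halfE.
  - exact unitI_dl_const.
  - intros xs half. apply unitI_eq. change half with unitI_half.
    rewrite unitI_halfE, unitI_dl_unfold. simpl. lra.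
  - intros xs ys join. apply unitI_eq. unfold join.
    assert (H : (proj1_sig (unitI_dl xs) <= proj1_sig (unitI_dl (fun n => unitI_op (xs n) (ys n))))%R).
    { apply dsum_le; intros n; destruct (xs n) as [x Hx], (ys n) as [y Hy]; simpl;
      unfold Rmin; destruct Rle_dec; lra. }
    destruct (unitI_dl xs) as [a Ha], (unitI_dl (fun n => unitI_op (xs n) (ys n))) as [b Hb].
    simpl in *. unfold Rmin. repeat destruct Rle_dec; lra.
  - intros x y half ominus. apply unitI_eq. change half with unitI_half. unfold ominus.
    rewrite unitI_halfE. simpl proj1_sig at 1.
    pose proof (unitI_halfE x) as Ex. pose proof (unitI_halfE y) as Ey.
    destruct (unitI_half x) as [a Ha], (unitI_half y) as [b Hb], x as [x Hx], y as [y Hy].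
    simpl in *. unfold Rmin. repeat destruct Rle_dec; lra.
Defined.

(** Induction on [t]: taking cuts commutes with every operation, so agreement on the variables
    extends to terms. *)
Lemma eval_unitI_cut (V : Type) (T : theory V) (M : term V -> Prop) (P : V -> Prop)
    (f : V -> unitI_deltaAlg) (t : term V) :
  maximal_ideal T M -> (forall v, P v -> cut M (Tvar v) (proj1_sig (f v))) ->
  term_in P t -> cut M t (proj1_sig (eval unitI_deltaAlg f t)).
Proof.
  intros HM Hf. pose proof (maximal_ideal_zero HM) as H0.
  induction t as [v|ts IH|s IHs t IHt|t IHt|]; intros Ht.
  - apply Hf, Ht. constructor.
  (* A valuation of all terms is fixed because the tails [Tdelta (fun k => ts (n + k))] are not
     covered by the induction hypothesis. Their values satisfy the recursion of [dsum_unique]. *)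
  - destruct (maximal_ideal_valuation HM) as [h Hh].
    assert (Hts : forall n, h (ts n) = proj1_sig (eval unitI_deltaAlg f (ts n))).
    { intros n. apply (cut_unique HM (Hh (ts n))). apply IH. intros v Hv.
      apply Ht. now apply occ_delta with n. }
    pose (r := fun n => h (Tdelta (fun k => ts (n + k)))).
    assert (Hr : forall n, (0 <= r n <= 1)%R).
    { intros n. exact (cut_range HM H0 (Hh _)). }
    assert (E : r 0 = dsum (fun n => h (ts n))).
    { apply dsum_unique; [intros n; exact (cut_range HM H0 (Hh _)) | exact Hr |].
      intros n. pose proof (@cut_dl V T M (fun k => ts (n + k)) (h (ts n)) (r (S n)) (r n) HM) as E.
      cbv beta in E. rewrite Nat.add_0_r in E. apply E; [apply Hh | | apply Hh].
      replace (fun k => ts (n + S k)) with (fun k => ts (S n + k)); [apply Hh|].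
      extensionality k. f_equal. lia. }
    simpl. rewrite <- (dsum_ext _ _ Hts), <- E. apply Hh.
  - destruct (cut_exists (Toplus s t) HM H0) as [p Hp]. simpl.
    rewrite <- (@cut_add V T M s t _ _ p HM); [exact Hp | | | exact Hp].
    + apply IHs. intros v Hv. apply Ht. now apply occ_oplus_l.
    + apply IHt. intros v Hv. apply Ht. now apply occ_oplus_r.
  - simpl. apply (cut_neg HM H0), IHt. intros v Hv. apply Ht. now apply occ_neg.
  - exact (cut_zero HM H0).
Qed.

(** The two sides of an equation of [T] are equal modulo [T], so they have the same cut, and cuts
    are unique. *)
Lemma models_unitI_cut (V : Type) (T : theory V) (M : term V -> Prop) (P : V -> Prop)
    (f : V -> unitI_deltaAlg) :
  maximal_ideal T M -> theory_in P T ->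
  (forall v, P v -> cut M (Tvar v) (proj1_sig (f v))) -> models unitI_deltaAlg f T.
Proof.
  intros HM HP Hf [s t] He. destruct (HP _ He) as [Ps Pt]. simpl in *.
  pose proof (eval_unitI_cut f HM Hf Ps) as Cs. pose proof (eval_unitI_cut f HM Hf Pt) as Ct.
  apply unitI_eq. apply (cut_unique HM Cs).
  assert (E : entails T (s, t)) by (intros A g Hg; exact (Hg _ He)).
  exact (cut_tle HM (maximal_ideal_zero HM) (entails_tle (entails_sym E)) (entails_tle E) Ct).
Qed.

(** * Terms over a set of variables, and the separation theorem *)

Lemma term_in_Tzero (V : Type) (P : V -> Prop) : term_in P Tzero.
Proof. intros v H. inversion H. Qed.

Lemma term_in_Tneg (V : Type) (P : V -> Prop) (t : term V) : term_in P t -> term_in P (Tneg t).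
Proof. intros H v Hv. apply H. now inversion Hv. Qed.

Lemma term_in_Toplus (V : Type) (P : V -> Prop) (s t : term V) :
  term_in P s -> term_in P t -> term_in P (Toplus s t).
Proof. intros Hs Ht v Hv. inversion Hv; auto. Qed.

Lemma term_in_Tsub (V : Type) (P : V -> Prop) (s t : term V) :
  term_in P s -> term_in P t -> term_in P (Tsub s t).
Proof. intros Hs Ht. now apply term_in_Tneg, term_in_Toplus; [apply term_in_Tneg|]. Qed.

Lemma term_in_Tmul (V : Type) (P : V -> Prop) (n : nat) (t : term V) :
  term_in P t -> term_in P (Tmul n t).
Proof.
  intros Ht. induction n; simpl; [apply term_in_Tzero | now apply term_in_Toplus].
Qed.

Lemma term_in_Tdyad (V : Type) (P : V -> Prop) (n k : nat) : term_in P (Tdyad n k).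
Proof.
  apply term_in_Tmul. induction n as [|n IH]; simpl.
  - apply term_in_Tneg, term_in_Tzero.
  - intros v Hv. inversion Hv as [|ts m Hm| | |]; subst.
    destruct m; [now apply IH | inversion Hm].
Qed.

Theorem mainTheorem4 (V : Type) (X Y Z : V -> Prop)
  (dXY : forall v, X v -> Y v -> False)
  (dXZ : forall v, X v -> Z v -> False)
  (dYZ : forall v, Y v -> Z v -> False)
  (S1 S2 : theory V)
  (h1 : theory_in (fun v => X v \/ Y v) S1)
  (h2 : theory_in (fun v => Y v \/ Z v) S2) :
  satisfiable (theory_union S1 S2) <->
  ~ (exists s : term V, term_in Y s /\
       entails S1 (s, Tzero) /\ entails S2 (s, Tone)).
Proof.
  split.
  - intros [A [f [[a [b Hab]] Hf]]] [s [_ [E1 E2]]]. apply Hab.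
    (* A separating term takes both values 0 and 1, which collapses the algebra. *)
    assert (H01 : zr A = ng A (zr A)).
    { transitivity (eval A f s).
      - symmetry. apply E1. intros e He. apply Hf. now left.
      - apply E2. intros e He. apply Hf. now right. }
    now rewrite <- (op_zero A a), <- (op_zero A b), H01, !op_one.
  - intros Hno.
    destruct (@exists_maximal_ideal V S1
                (fun t => term_in Y t /\ entails S2 (t, Tzero))) as [M1 [HM1 G1]].
    { split; [apply term_in_Tzero | easy]. }
    { intros s t [Ys Es] [Yt Et]. split; [now apply term_in_Toplus|].
      intros A f Hf. pose proof (Es A f Hf) as Fs. pose proof (Et A f Hf) as Ft.
      simpl in *. now rewrite Fs, Ft, op_zero. }
    (* If [S1] proves [t] equal to 1 and [S2] proves it equal to 0, then [Tneg t] separates the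
       theories. *)
    { intros t [Yt Et] E. apply Hno. exists (Tneg t).
      split; [now apply term_in_Tneg|]. split; intros A f Hf; simpl.
      - pose proof (E A f Hf) as F. simpl in F. now rewrite F, ng_ng.
      - pose proof (Et A f Hf) as F. simpl in F. now rewrite F. }
    pose proof (maximal_ideal_zero HM1) as Z1.
    destruct (@exists_maximal_ideal V S2 (fun t => term_in Y t /\ M1 t)) as [M2 [HM2 G2]].
    { split; [apply term_in_Tzero | exact Z1]. }
    { intros s t [Ys Es] [Yt Et].
      split; [now apply term_in_Toplus | exact (ideal_add HM1 Es Et)]. }
    (* If [S2] proves [t] equal to 1, then it proves [Tneg t] equal to 0, so [M1] contains [t] and
       [Tneg t], hence 1. *)
    { intros t [Yt Mt] E. apply (ideal_proper HM1).
      assert (Mn : M1 (Tneg t)).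
      { apply G1. split; [now apply term_in_Tneg|]. intros A f Hf.
        pose proof (E A f Hf) as F. simpl in *. now rewrite F, ng_ng. }
      apply (ideal_down HM1 (ideal_add HM1 Mn Mt)). intros A f _. simpl.
      rewrite ng_op_self. apply le_refl. }
    pose proof (maximal_ideal_zero HM2) as Z2.
    (* For a [Y]-term [t] in [M2] but not in [M1], some [¬ (n t)] is in [M1] and thus in [M2], which
       also contains [n t]. *)
    assert (Hagree : forall t, term_in Y t -> (M1 t <-> M2 t)).
    { intros t Yt. split; [now intros H; apply G2|]. intros H. apply NNPP. intros Hn.
      destruct (maximal_ideal_compl HM1 _ Hn) as [n Mn].
      apply (ideal_proper HM2).
      assert (Mn2 : M2 (Tneg (Tmul n t))).
      { apply G2. split; [now apply term_in_Tneg, term_in_Tmul | exact Mn]. }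
      apply (ideal_down HM2 (ideal_add HM2 Mn2 (ideal_Tmul n HM2 Z2 H))).
      intros A f _. simpl. rewrite ng_op_self. apply le_refl. }
    assert (Hval : forall v, exists x : unitI_deltaAlg,
      (X v \/ Y v -> cut M1 (Tvar v) (proj1_sig x)) /\
      (Y v \/ Z v -> cut M2 (Tvar v) (proj1_sig x))).
    { intros v.
      destruct (cut_exists (Tvar v) HM1 Z1) as [r Hr].
      destruct (cut_exists (Tvar v) HM2 Z2) as [q Hq].
      (* Variables in [Z] take their value from [M2], all others from [M1]. A variable in [Z] is in
         neither [X] nor [Y], so the first clause is vacuous for it. *)
      destruct (classic (Z v)) as [Hz|Hz].
      - exists (exist _ q (cut_range HM2 Z2 Hq)). split; [|easy].
        intros [H|H]; exfalso; eauto.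
      - exists (exist _ r (cut_range HM1 Z1 Hr)). split; [easy|].
        intros [H|H]; [|easy]. simpl.
        assert (Yv : term_in Y (Tvar v)) by (intros w Hw; now inversion Hw; subst).
        (* Dyadic constants contain no variables, so for [v] in [Y] the cut compares [Y]-terms only,
           on which [M1] and [M2] agree. *)
        intros n k. rewrite <- !Hagree; [apply Hr | |];
        apply term_in_Tsub; auto using term_in_Tdyad. }
    pose (f v := proj1_sig (constructive_indefinite_description _ (Hval v))).
    assert (Hf : forall v, (X v \/ Y v -> cut M1 (Tvar v) (proj1_sig (f v))) /\
                           (Y v \/ Z v -> cut M2 (Tvar v) (proj1_sig (f v)))).
    { intros v. unfold f. now destruct constructive_indefinite_description. }
    exists unitI_deltaAlg, f. split.
    + exists (zr unitI_deltaAlg), (ng unitI_deltaAlg (zr unitI_deltaAlg)).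
      intros H. apply (f_equal (@proj1_sig _ _)) in H. simpl in H. lra.
    + intros e [He|He].
      * exact (models_unitI_cut f HM1 h1 (fun v => proj1 (Hf v)) e He).
      * exact (models_unitI_cut f HM2 h2 (fun v => proj2 (Hf v)) e He).
Qed.
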